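(* Let $(T,+)$ be a commutative semigroup, let $k,m,n\in\mathbb N$, and let $M$ be a $k\times m$ matrix. If $T$ is not cancellative assume that the entries of $M$ come from $\omega=\{0,1,2,\dots\}$; if $T$ is isomorphic to a subsemigroup of a direct sum of copies of $(\mathbb Q,+)$, assume that the entries of $M$ come from $\mathbb Q$; otherwise assume that the entries of $M$ come from $\mathbb Z$. For $i\in\{1,\dots,m\}$ let $\tau_i$ be an $S_0$-independent homomorphism from $S_n$ to $T$, and define $\psi$ on $S_n$ by $\psi(w)=(\tau_1(w),\tau_2(w),\ldots,\tau_m(w))^{T}$ (a column vector). Let $\vec p=(p_1,\ldots,p_k)$ be an idempotent in $\prod_{i=1}^k\beta T$ with the property that whenever $B_i\in p_i$ for each $i\in\{1,\dots,k\}$, there exists $\vec z\in\psi[S_n]$ such that $M\vec z\in\prod_{i=1}^k B_i$. Let $F$ be a finite nonempty set of $S_0$-preserving homomorphisms from $S_n$ to $S_0$ and let $D$ be a piecewise syndetic subset of $S_0$. Then whenever $B_i\in p_i$ for each $i\in\{1,\dots,k\}$, there exists $w\in S_n$ such that $\nu(w)\in D$ for every $\nu\in F$ and $M\psi(w)\in\prod_{i=1}^kB_i$.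
   Context: $\mathbb A$ is a fixed nonempty finite alphabet, $S_0=\mathbb A^+$ the free semigroup of nonempty words over $\mathbb A$ under concatenation, and $v_1,v_2,\dots$ are distinct variables not in $\mathbb A$. For $n\in\mathbb N$, $S_n$ is the set of $n$-variable words: nonempty finite words over $\mathbb A\cup\{v_1,\dots,v_n\}$ in which each $v_i$, $1\le i\le n$, occurs; $S_n$ is a semigroup under concatenation and an ideal of $S_0\cup S_n$. A homomorphism $\tau:S_n\to R$ is $S_0$-independent if $\tau(uw)=\tau(w)=\tau(wu)$ for all $w\in S_n$, $u\in S_0$. A homomorphism $\nu:S_n\to S_0$ is $S_0$-preserving if $\nu(uw)=u\nu(w)$ and $\nu(wu)=\nu(w)u$ for all $u\in S_0$, $w\in S_n$. For a discrete semigroup $X$, $\beta X$ is the Stone–Čech compactification (ultrafilters on $X$), a compact right topological semigroup with the extended operation ($A\in p+q$ iff $\{x:-x+A\in q\}\in p$ where $-x+A=\{y:x+y\in A\}$); $\prod_{i=1}^k\beta T$ has the product topology and coordinatewise operation. $K(\beta X)$ is the smallest two-sided ideal of $\beta X$; $D\subseteq X$ is piecewise syndetic if $D\in p$ for some $p\in K(\beta X)$. *)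

(* Defs.v *)
From HB Require Import structures.
From mathcomp Require Import all_boot all_order all_algebra.
From mathcomp Require Import boolp classical_sets cardinality filter.

Set Implicit Arguments.
Unset Strict Implicit.
Unset Printing Implicit Defensive.

Import Order.TTheory GRing.Theory Num.Theory.
Local Open Scope classical_set_scope.
Local Open Scope ring_scope.

Section Words.
Variable A : Type.

Definition word : Type := {w : seq A | ~~ nilp w}.

Lemma cat_neq_nil (u w : word) : ~~ nilp (val u ++ val w).
Proof. by case: u => -[]. Qed.

Definition word_cat (u w : word) : word :=
  exist (fun s => is_true (~~ nilp s)) (val u ++ val w) (cat_neq_nil u w).

End Words.

Section VariableWords.
Variables (A : eqType) (n : nat).

(* The variables v_1, ..., v_n are encoded as [inr i] with [i : 'I_n]. *)
Definition is_vword (s : seq (A + 'I_n)) : bool :=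
  ~~ nilp s && [forall i : 'I_n, inr i \in s].

Definition vword : Type := {w : seq (A + 'I_n) | is_vword w}.

Lemma is_vword_catl (s t : seq (A + 'I_n)) : is_vword t -> is_vword (s ++ t).
Proof.
move=> /andP[t0 /forallP tv]; apply/andP; split; first by case: s t t0 {tv} => [|? ?] [].
by apply/forallP => i; rewrite mem_cat tv orbT.
Qed.

Lemma is_vword_catr (s t : seq (A + 'I_n)) : is_vword s -> is_vword (s ++ t).
Proof.
move=> /andP[s0 /forallP sv]; apply/andP; split; first by case: s s0 {sv}.
by apply/forallP => i; rewrite mem_cat sv.
Qed.

Definition vword_cat (u w : vword) : vword :=
  exist is_vword (val u ++ val w) (is_vword_catl (val u) (valP w)).

Definition vword_catl (u : word A) (w : vword) : vword :=
  exist is_vword (map inl (val u) ++ val w) (is_vword_catl _ (valP w)).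

Definition vword_catr (w : vword) (u : word A) : vword :=
  exist is_vword (val w ++ map inl (val u)) (is_vword_catr _ (valP w)).

Definition S0_independent_hom (T : addSemigroupType) (tau : vword -> T) : Prop :=
  (forall u w, tau (vword_cat u w) = tau u + tau w) /\
  (forall (u : word A) (w : vword),
     tau (vword_catl u w) = tau w /\ tau (vword_catr w u) = tau w).

Definition S0_preserving_hom (nu : vword -> word A) : Prop :=
  (forall u w, nu (vword_cat u w) = word_cat (nu u) (nu w)) /\
  (forall (u : word A) (w : vword),
     nu (vword_catl u w) = word_cat u (nu w) /\
     nu (vword_catr w u) = word_cat (nu w) u).

End VariableWords.

Section StoneCech.
Variables (X : Type) (op : X -> X -> X).

Record beta : Type := Beta {
  beta_sets :> set_system X;
  beta_ultra : UltraFilter beta_sets }.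

Definition ultra_op (p q : set_system X) : set_system X :=
  [set B | p [set x | q [set y | B (op x y)]]].

Lemma ultra_op_ultra (p q : beta) : UltraFilter (ultra_op p q).
Proof.
case: p q => [p pU] [q qU]; rewrite /ultra_op /=.
have PF : ProperFilter [set B | p [set x | q [set y | B (op x y)]]].
  split=> [/= H|].
    apply: (@filter_not_empty X p _); apply: (@filterS X p) H => x /=.
    exact: (@filter_not_empty X q _).
  split=> /= [|P Q|P Q PQ].
  - by apply: (@filterS X p) (@filterT X p _) => x _; apply: (@filterT X q).
  - by apply: (@filterS2 X p) => x; apply: (@filterI X q).
  - by apply: (@filterS X p) => x; apply: (@filterS X q) => y; apply: PQ.
split=> // G GF sub; rewrite eqEsubset; split => // B GB /=.
have [//|npB] := in_ultra_setVsetC [set x | q [set y | B (op x y)]] pU.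
have : G (~` B).
  apply: sub => /=; apply: filterS npB => x /= nq.
  by have [//|] := in_ultra_setVsetC [set y | B (op x y)] qU.
move=> GnB; exfalso; apply: (@filter_not_empty X G GF).
by rewrite -(setICr B); apply: (@filterI X G).
Qed.

Definition beta_op (p q : beta) : beta := Beta (ultra_op_ultra p q).

Definition two_sided_ideal (J : set beta) : Prop :=
  J !=set0 /\ (forall p q, J q -> J (beta_op p q) /\ J (beta_op q p)).

Definition smallest_ideal : set beta :=
  [set p | forall J, two_sided_ideal J -> J p].

Definition piecewise_syndetic (D : set X) : Prop :=
  exists2 p, smallest_ideal p & beta_sets p D.

End StoneCech.

Section MatrixAction.
Variable T : addSemigroupType.

Definition cancellative : Prop := forall x y z : T, x + y = x + z -> y = z.

(* An isomorphism of T onto a subsemigroup of a direct sum of copies of Q,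
   the direct sum being the finitely supported functions on an index type. *)
Record rational_embedding : Type := RationalEmbedding {
  re_index : Type;
  re_fun :> T -> re_index -> rat;
  re_finsupp : forall x, finite_set [set c | re_fun x c != 0];
  re_add : forall x y c, re_fun (x + y) c = re_fun x c + re_fun y c;
  re_inj : injective re_fun }.

Definition rational_embeddable : Prop := inhabited rational_embedding.

(* The group of differences T - T, up to isomorphism. *)
Record difference_group : Type := DifferenceGroup {
  dg_group : zmodType;
  dg_fun :> T -> dg_group;
  dg_add : {morph dg_fun : x y / x + y};
  dg_inj : injective dg_fun;
  dg_gen : forall g, exists x y, g = dg_fun x - dg_fun y }.

(* [is_sum s b]: b is the sum of the entries of s. The empty sum is the identity
   of T; when T has none, it is an adjoined identity, hence not in T. *)
Definition is_sum (s : seq T) (b : T) : Prop :=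
  if s is x :: s' then b = foldl +%R x s' else forall x, b + x = x.

(* [lin_comb q z b]: the product of the row q and the column z is the element b
   of T. In the first case each z_j is repeated q_j times, so that terms with
   coefficient 0 are omitted; otherwise the product is computed in the ambient
   group, and does not depend on the choice of the embedding. *)
Inductive lin_comb (m : nat) (q : 'rV[rat]_m) (z : 'cV[T]_m) (b : T) : Prop :=
| LinCombNat of ~ cancellative &
    exists2 a : 'I_m -> nat, forall j, q ord0 j = (a j)%:R &
      is_sum (flatten [seq nseq (a j) (z j ord0) | j <- enum 'I_m]) b
| LinCombRat of
    exists f : rational_embedding,
      forall c, f b c = \sum_(j < m) q ord0 j * f (z j ord0) c
| LinCombInt of cancellative & ~ rational_embeddable &
    exists2 a : 'I_m -> int, forall j, q ord0 j = (a j)%:~R &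
      exists f : difference_group, f b = \sum_(j < m) f (z j ord0) *~ a j.

Definition admissible_matrix (k m : nat) (M : 'M[rat]_(k, m)) : Prop :=
  (~ cancellative -> forall i j, M i j \is a Num.nat) /\
  (cancellative -> ~ rational_embeddable -> forall i j, M i j \is a Num.int).

(* [M z] lies in the product of the sets [B i]. *)
Definition mulmx_in (k m : nat) (M : 'M[rat]_(k, m)) (z : 'cV[T]_m)
    (B : 'I_k -> set T) : Prop :=
  forall i, exists2 b, B i b & lin_comb (row i M) z b.

End MatrixAction.

Definition psi (A : eqType) (n m : nat) (T : addSemigroupType)
    (tau : 'I_m -> vword A n -> T) (w : vword A n) : 'cV[T]_m :=
  \col_j tau j w.

(* Main.v *)
(* The ultrafilters q on the variable words whose image under w |-> M psi(w) is
   p form a nonempty closed subsemigroup Q of beta(S_0 u S_n), and multiplying Q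
   by ultrafilters on S_0 on either side does not leave Q, because each tau_i is
   S_0-independent. Choose an idempotent r of beta S_0 in a minimal left ideal
   such that some translate x^-1 D lies in r. The closed semigroup Q r contains an
   idempotent e, and f := r e is then an idempotent in Q with f <= r. Each nu in F,
   extended by the identity of S_0, induces a homomorphism fixing r, so nu(f) <= r,
   whence nu(f) = r by minimality. A word w in the members of f given by the
   nu^-1(x^-1 D) and by B yields the required word x w. *)

Require Import Defs.
From mathcomp Require Import all_boot all_order all_algebra.
From mathcomp Require Import boolp classical_sets cardinality filter.

Local Open Scope classical_set_scope.
Local Open Scope ring_scope.

(** * Closed sets of ultrafilters: compactness and minimal closed sets *)

Section StoneCechTopology.
Set Implicit Arguments.
Unset Strict Implicit.
Variable X : Type.
Implicit Types (p q r : beta X) (C : set (beta X)) (B : set X).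

#[global] Instance beta_proper p : ProperFilter (beta_sets p).
Proof. by case: p => s [sP]. Qed.

Lemma beta_inj p q : (forall B, beta_sets p B -> beta_sets q B) -> p = q.
Proof.
case: p q => [p pU] [q qU] /= pq.
have qp : q = p by apply: max_filter.
by rewrite {}qp in qU pq *; rewrite (Prop_irrelevance pU qU).
Qed.

Lemma betaC p B : beta_sets p B \/ beta_sets p (~` B).
Proof. by apply: in_ultra_setVsetC; case: p. Qed.

Definition common_sets C : set_system X := [set B | forall p, C p -> beta_sets p B].

Lemma beta_extend (G : set_system X) :
  ProperFilter G -> exists p : beta X, G `<=` beta_sets p.
Proof.
by move=> /ultraFilterLemma[p [pU Gp]]; exists (Beta pU).
Qed.

(* [C] is closed iff it consists of all ultrafilters above some filter. *)
Definition beta_closed C := forall p, common_sets C `<=` beta_sets p -> C p.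

(** Compactness: as the chain is total, the sets common to all points of some member form a proper
    filter, and an ultrafilter above it lies in every member by closedness. *)
Lemma beta_closed_chain (S : set (set (beta X))) :
  S !=set0 -> (forall C, S C -> beta_closed C /\ C !=set0) ->
  total_on S subset ->
  beta_closed (\bigcap_(C in S) C) /\ (\bigcap_(C in S) C) !=set0.
Proof.
move=> [C0 SC0] Scl Stot; split.
  move=> p pS C SC; apply: (Scl C SC).1 => B CB.
  by apply: pS => q /(_ C SC); apply: CB.
suff GP : ProperFilter [set B | exists2 C, S C & common_sets C B].
  have [p Gp] := beta_extend GP.
  by exists p => C SC; apply: (Scl C SC).1 => B CB; apply: Gp; exists C.
split=> [[C SC]|].
  by have [q Cq] := (Scl C SC).2; move=> /(_ q Cq); apply: filter_not_empty.
split=> [|P Q [C SC CP] [C' SC' CQ]|P Q PQ [C SC CP]].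
- by exists C0 => // p _; apply: filterT.
- have [CC'|C'C] := Stot _ _ SC SC'.
    by exists C => // p Cp; apply: filterI; [apply: CP|apply/CQ/CC'].
  by exists C' => // p Cp; apply: filterI; [apply/CP/C'C|apply: CQ].
- by exists C => // p Cp; apply: filterS PQ _; apply: CP.
Qed.

(** Zorn's lemma for unions, applied to the part [U] removed from [C0]. Later [Q] means being a
    subsemigroup or a left ideal. *)
Lemma minimal_closed (Q : set (set (beta X))) C0 :
  (forall S : set (set (beta X)), S !=set0 -> S `<=` Q ->
     Q (\bigcap_(C in S) C)) ->
  Q C0 -> beta_closed C0 -> C0 !=set0 ->
  exists C, [/\ Q C, beta_closed C, C !=set0, C `<=` C0 &
    forall C', Q C' -> beta_closed C' -> C' !=set0 -> C' `<=` C -> C `<=` C'].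
Proof.
move=> Qcap QC0 clC0 C0n.
pose good C := [/\ Q C, beta_closed C & C !=set0].
pose P (U : set (beta X)) := good (C0 `\` U).
have [F FP Ftot|U [[QU clU Un] Umax]] := @Zorn_bigcup (beta X) P.
  have [->|/set0P[U0 FU0]] := eqVneq F set0; first by rewrite /P bigcup_set0 setD0.
  pose S := [set C0 `\` U | U in F].
  have Sn : S !=set0 by exists (C0 `\` U0); exists U0.
  have Stot : total_on S subset.
    move=> _ _ [U FU <-] [V FV <-].
    by have [UV|VU] := Ftot _ _ FU FV; [right|left]; apply: setDS.
  have Sgood C : S C -> good C by move=> [U FU <-]; apply: FP.
  have -> : P (\bigcup_(U in F) U) = good (\bigcap_(C in S) C).
    congr good; apply/seteqP; split=> [p [C0p FU] _ [U FU' <-]|p pS].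
      by split=> // Up; apply: FU; exists U.
    split; first by have [] := pS _ (ex_intro2 _ _ U0 FU0 erefl).
    by move=> [U FU Up]; have [_ /(_ Up)] := pS _ (ex_intro2 _ _ U FU erefl).
  have Scl C : S C -> beta_closed C /\ C !=set0 by move=> /Sgood[].
  have [clS neS] := beta_closed_chain Sn Scl Stot.
  by split=> //; apply: Qcap => // C /Sgood[].
exists (C0 `\` U); split=> // C' QC' clC' C'n C'C p [C0p Up].
apply: contrapT => C'p; apply: (Umax (~` C')).
  split=> [q Uq C'q|C'U]; first by have [_ /(_ Uq)] := C'C _ C'q.
  by apply: Up; apply: C'U.
rewrite /P setDE setCK (_ : _ `&` _ = C') //.
by apply/setIidPr => q /C'C[].
Qed.

End StoneCechTopology.

(** * Idempotents and minimal left ideals *)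

Section StoneCechSemigroup.
Set Implicit Arguments.
Unset Strict Implicit.
Variables (X : Type) (op : X -> X -> X).
Hypothesis opA : associative op.
Implicit Types (p q r s : beta X) (C : set (beta X)) (B : set X).
Local Notation "p ** q" := (beta_op op p q) (at level 40, left associativity).

Lemma beta_opA p q r : p ** (q ** r) = p ** q ** r.
Proof.
apply: beta_inj => B /=; rewrite /ultra_op /=.
apply: filterS => x; apply: filterS => y; apply: filterS => z /=.
by rewrite opA.
Qed.

(** Right translation is continuous and [C] is compact. For [u] adherent to the image, a preimage is
    any ultrafilter containing the common sets of [C] and all [ev B] with [B] in [u]. *)
Lemma beta_closed_mulr C q :
  beta_closed C -> beta_closed [set p ** q | p in C].
Proof.
move=> clC u uC; pose ev B := [set x | beta_sets q [set y | B (op x y)]].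
(* If [Y] missed [ev B], every [p ** q] with [p] in [C] would contain the complement of [B], hence
   so would [u]. *)
have uev B : beta_sets u B -> forall Y, common_sets C Y -> Y `&` ev B !=set0.
  move=> uB Y CY; apply: contrapT => /set0P/negP/negPn/eqP Y0.
  have : beta_sets u (~` B).
    apply: uC => _ [p Cp <-] /=; apply: filterS (CY p Cp) => x Yx.
    have [qB|//] := betaC q [set y | B (op x y)].
    by have : (Y `&` ev B) x by []; rewrite Y0.
  by move=> /(filterI uB); rewrite setICr; apply: filter_not_empty.
pose G := [set W | exists Y B, [/\ common_sets C Y, beta_sets u B &
  Y `&` ev B `<=` W]].
have GP : ProperFilter G.
  split=> [[Y [B [CY uB]]]|].
    by have [x Yx] := uev B uB Y CY; move=> /(_ x Yx).
  split=> [|P Q [Y [B [CY uB YP]]] [Z [D [CZ uD ZQ]]]|P Q PQ [Y [B [CY uB YP]]]].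
  - exists setT, setT; split=> //; last exact: filterT.
    by move=> p _; apply: filterT.
  - exists (Y `&` Z), (B `&` D); split; last 1 first.
    + move=> x [[Yx Zx] BDx]; split; [apply: YP|apply: ZQ]; split=> //;
      by apply: filterS BDx => y [].
    + by move=> p Cp; apply: filterI; [apply: CY|apply: CZ].
    + exact: filterI.
  - by exists Y, B; split=> // x /YP/PQ.
have [p Gp] := beta_extend GP.
exists p.
  apply: clC => Y CY; apply: Gp; exists Y, setT; split=> //; exact: filterT.
apply/esym/beta_inj => B uB /=; apply: Gp; exists setT, B; split=> //.
by move=> r _; apply: filterT.
Qed.

Lemma beta_closed_fiber C q u :
  beta_closed C -> beta_closed [set p | C p /\ p ** q = u].
Proof.
move=> clC p pC; split.
  by apply: clC => B CB; apply: pC => r [Cr _]; apply: CB.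
apply/esym/beta_inj => B uB /=; apply: pC => r [_ rq].
by rewrite -rq in uB.
Qed.

(* The Ellis-Numakura lemma. *)
Lemma beta_idempotent C :
  beta_closed C -> C !=set0 -> (forall p q, C p -> C q -> C (p ** q)) ->
  exists2 p, C p & p ** p = p.
Proof.
move=> clC Cn Cmul.
pose Q (E : set (beta X)) := forall p q, E p -> E q -> E (p ** q).
have [|E [QE clE [p Ep] EC Emin]] := @minimal_closed X Q C _ Cmul clC Cn.
  move=> S _ SQ p q Sp Sq E SE.
  by apply: SQ => //; [apply: Sp|apply: Sq].
exists p; first exact: EC.
have [q Eq qp] : [set q ** p | q in E] p.
  apply: (Emin [set q ** p | q in E] _ _ _ _ _ Ep).
  - move=> _ _ [q Eq <-] [r Er <-]; rewrite beta_opA.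
    by exists (q ** p ** r) => //; apply: (QE) => //; apply: QE.
  - exact: beta_closed_mulr.
  - by exists (p ** p); exists p.
  - by move=> _ [q Eq <-]; apply: QE.
have [] // : [set q | E q /\ q ** p = p] p.
apply: (Emin [set q | E q /\ q ** p = p] _ _ _ _ _ Ep).
- by move=> r s [Er rp] [Es sp]; split; [apply: QE|rewrite -beta_opA sp].
- exact: beta_closed_fiber.
- by exists q.
- by move=> r [].
Qed.

(* [p] lies in the union of the minimal left ideals. *)
Definition left_simple p := forall t, exists u, p = u ** t ** p.

(** Any point [p] of a minimal closed left ideal [E] works: the [u ** (t ** p)] form a closed left
    ideal inside [E], hence all of [E]. *)
Lemma exists_left_simple : beta X -> exists p, left_simple p.
Proof.
move=> p0; pose Q (E : set (beta X)) := forall p q, E q -> E (p ** q).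
have clT : beta_closed [set: beta X] by [].
have [|//||E [QE clE [p Ep] _ Emin]] := @minimal_closed X Q setT _ _ clT.
- by move=> S _ SQ p q Sq E SE; apply: SQ => //; apply: Sq.
- by exists p0.
exists p => t.
suff [v _ vp] : [set u ** (t ** p) | u in setT] p by exists v; rewrite -beta_opA.
apply: (Emin [set u ** (t ** p) | u in setT] _ _ _ _ _ Ep).
- by move=> q _ [u _ <-]; exists (q ** u) => //; rewrite -beta_opA.
- exact: beta_closed_mulr.
- by exists (p ** (t ** p)); exists p.
- by move=> _ [u _ <-]; apply: (QE); apply: QE.
Qed.

(** The left simple points form a two-sided ideal. *)
Lemma smallest_ideal_left_simple p : smallest_ideal op p -> left_simple p.
Proof.
apply; split=> [|q r qs]; first by have [r] := exists_left_simple p; exists r.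
split=> t.
  by have [u ru] := qs (t ** q); exists (q ** u); rewrite {1}ru !beta_opA.
by have [u ru] := qs t; exists u; rewrite {1}ru -!beta_opA.
Qed.

(** Here [r = v ** p] is an idempotent of the closed left ideal of all [u ** p]. For an idempotent
    [f] below [r] there is [u] with [p = u ** f], so [r ** f = v ** u ** f ** f = r]. *)
Lemma left_simple_idempotent p : left_simple p ->
  exists r, [/\ r ** r = r, p ** r = p &
    forall f, f ** f = f -> f ** r = f -> r ** f = f -> f = r].
Proof.
move=> ps; have clT : beta_closed [set: beta X] by [].
have [||_ _ [v _ <-] [w _ <-]|_ [v _ <-] vv] :=
    @beta_idempotent [set u ** p | u in setT].
- exact: beta_closed_mulr.
- by exists (p ** p); exists p.
- by exists (v ** p ** w) => //; rewrite -!beta_opA.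
exists (v ** p); split=> // [|f ff fr rf].
  by have [u pu] := ps v; rewrite {1}pu -!beta_opA [v ** _]beta_opA vv beta_opA -pu.
have [u pu] := ps (f ** v).
have pf : p = u ** f by rewrite pu -[u ** _ ** p]beta_opA -[f ** v ** p]beta_opA fr.
by rewrite -{}rf pf -!beta_opA ff.
Qed.

End StoneCechSemigroup.

(** * Additivity of linear combinations in [T] *)

Section LinearCombinations.
Set Implicit Arguments.
Unset Strict Implicit.
Import GRing.Theory.
Variable T : addSemigroupType.

(* Addition of [T] with an identity [None] adjoined. *)
Local Notation oadd := (oAC (@Algebra.addrA T) (@Algebra.addrC T)).

(** [None] is the empty sum, so a coefficient 0 contributes nothing even if [T] has no identity. *)
Definition onmul (x : T) (d : nat) : option T := iter d (oadd (Some x)) None.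

Definition onsum (m : nat) (a : 'I_m -> nat) (z : 'I_m -> T) : option T :=
  \big[oadd/None]_j onmul (z j) (a j).

Lemma onmulD x y d : onmul (x + y) d = oadd (onmul x d) (onmul y d).
Proof.
elim: d => //= d ->; rewrite -[Some (x + y)]/(oadd (Some x) (Some y)).
exact: Monoid.mulmACA.
Qed.

Lemma onsumD m (a : 'I_m -> nat) (y z : 'I_m -> T) :
  onsum a (fun j => y j + z j) = oadd (onsum a y) (onsum a z).
Proof. by rewrite -big_split; apply: eq_bigr => j _; apply: onmulD. Qed.

Lemma is_sumE (s : seq T) b :
  is_sum s b <-> if \big[oadd/None]_(x <- s) Some x is Some c then b = c
                 else forall x, b + x = x.
Proof.
case: s => [|x s]; first by rewrite big_nil.
suff -> : \big[oadd/None]_(y <- x :: s) Some y = Some (foldl +%R x s) by [].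
elim: s x => [|y s IH] x; first by rewrite big_seq1.
by rewrite /= -IH !big_cons Monoid.mulmA.
Qed.

Lemma big_nseq_onmul m (a : 'I_m -> nat) (z : 'I_m -> T) :
  \big[oadd/None]_(x <- flatten [seq nseq (a j) (z j) | j <- enum 'I_m]) Some x
  = onsum a z.
Proof.
rewrite big_flatten big_map big_enum; apply: eq_bigr => j _.
by rewrite big_nseq.
Qed.

Section Additive.
Variables (V : zmodType) (h : T -> V).
Hypothesis hD : {morph h : x y / x + y}.

Lemma oapp_oadd o o' : oapp h 0 (oadd o o') = oapp h 0 o + oapp h 0 o'.
Proof. by case: o o' => [x|] [y|] //=; rewrite ?addr0 ?add0r ?hD. Qed.

Lemma oapp_onmul x d : oapp h 0 (onmul x d) = h x *+ d.
Proof.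
elim: d => // d IH.
by rewrite /onmul iterS oapp_oadd -/(onmul x d) IH mulrS.
Qed.

Lemma oapp_onsum m (a : 'I_m -> nat) (z : 'I_m -> T) :
  oapp h 0 (onsum a z) = \sum_j h (z j) *+ a j.
Proof.
rewrite /onsum (big_morph _ oapp_oadd (erefl : oapp h 0 None = 0)).
by apply: eq_bigr => j _; rewrite oapp_onmul.
Qed.

End Additive.

(* Moving negative terms to the other side and adding [b] to both sides turns
   the relation into an equation in [T], which mentions neither embedding. *)
Lemma int_relation_transfer (V W : zmodType) (I J : Type)
    (h : T -> I -> V) (g : T -> J -> W) m (a : 'I_m -> int) d z b :
  (forall x y c, h (x + y) c = h x c + h y c) ->
  (forall x y c, g (x + y) c = g x c + g y c) -> injective h ->
  (forall c, h b c *+ d = \sum_j h (z j) c *~ a j) ->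
  forall c, g b c *+ d = \sum_j g (z j) c *~ a j.
Proof.
move=> hD gD hI hb.
have /choice[P /choice[N aPN]] : forall j, exists P N : nat, a j = P%:Z - N%:Z.
  move=> j; case: (a j) => e; first by exists e, 0%N; rewrite subr0.
  by exists 0%N, e.+1; rewrite sub0r NegzE.
(* [oapp (+%R b) b] adds [b] and sends the adjoined identity to [b], so [l] and [r] lie in [T]. *)
pose l := oapp (+%R b) b (oadd (onmul b d) (onsum N z)).
pose r := oapp (+%R b) b (onsum P z).
(* Each relation amounts to [f l = f r]; injectivity of [h] yields [l = r], whence the relation for
   [g]. *)
have key (U : zmodType) (f : T -> U) : {morph f : x y / x + y} ->
    (f b *+ d = \sum_j f (z j) *~ a j) <-> f l = f r.
  move=> fD; have fo o : f (oapp (+%R b) b o) = f b + oapp f 0 o.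
    by case: o => [x|] /=; rewrite ?addr0 ?fD.
  rewrite !fo oapp_oadd // oapp_onmul // !oapp_onsum //.
  have -> : \sum_j f (z j) *~ a j = \sum_j f (z j) *+ P j - \sum_j f (z j) *+ N j.
    by rewrite -sumrB; apply: eq_bigr => j _; rewrite aPN mulrzBr.
  by split=> [->|/addrI <-]; rewrite ?subrK ?addrK.
have lr : l = r.
  by apply/hI/funext => c; apply/(key _ (h^~ c)) => //; move=> x y; apply: hD.
by move=> c; apply/(key _ (g^~ c)); rewrite ?lr // => x y; apply: gD.
Qed.

Lemma common_denominator m (q : 'I_m -> rat) :
  exists2 d : nat, (0 < d)%N &
    exists a : 'I_m -> int, forall j, q j * d%:R = (a j)%:~R.
Proof.
pose D := \prod_j denq (q j).
have D0 : 0 < D by apply: Num.Theory.prodr_gt0 => j _; apply: denq_gt0.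
exists `|D|%N; first by rewrite absz_gt0 Num.Theory.lt0r_neq0.
suff /choice[a aP] : forall j, exists e : int, q j * `|D|%N%:R = e%:~R by exists a.
move=> j; exists (numq (q j) * \prod_(i | i != j) denq (q i)).
rewrite -[_%:R]/(`|D|%N%:~R) gtz0_abs // /D (bigD1 j) //= !rmorphM /=.
by rewrite mulrA numqE.
Qed.

(** A common denominator [d] makes the coefficients integral, and the factor [d] cancels in
    [rat]. *)
Lemma rational_embedding_transfer (f g : rational_embedding T) m
    (q : 'I_m -> rat) z b :
  (forall c, f b c = \sum_j q j * f (z j) c) ->
  forall c, g b c = \sum_j q j * g (z j) c.
Proof.
move=> fb; have [d d0 [a qa]] := common_denominator q.
have scale (I : Type) (h : T -> I -> rat) c :
    h b c = \sum_j q j * h (z j) c <->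
    h b c *+ d = \sum_j h (z j) c *~ a j.
  have -> : \sum_j h (z j) c *~ a j = (\sum_j q j * h (z j) c) *+ d.
    rewrite -sumrMnl; apply: eq_bigr => j _.
    by rewrite -mulrzr -qa mulrCA mulrA mulr_natr.
  by split=> [->//|]; apply: Num.Theory.pmulrnI.
move=> c; apply/scale; apply: (int_relation_transfer (h := f)) => //.
- exact: re_add.
- exact: re_add.
- exact: re_inj.
- by move=> e; apply/scale.
Qed.

Lemma rational_embeddable_cancellative : rational_embeddable T -> cancellative T.
Proof.
move=> [f] x y z exy; apply: (@re_inj _ f); apply/funext => c.
by have := congr1 (f^~ c) exy; rewrite /= !re_add => /addrI.
Qed.

(** The three cases of [lin_comb] exclude one another, so both hypotheses fall under the same one;
    if embeddings occur, the second relation is transferred to the embedding of the first. *)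
Lemma lin_combD m (q : 'rV[rat]_m) (y z : 'cV[T]_m) (b c : T) :
  lin_comb q y b -> lin_comb q z c ->
  lin_comb q (\col_j (y j ord0 + z j ord0)) (b + c).
Proof.
case=> [nc [a qa sb]|[f fb]|canc nr [a qa [f fb]]].
- case=> [_ [a' qa' sc]|[g _]|//]; last first.
    by case: nc; apply: rational_embeddable_cancellative.
  have aa' : a' = a.
    apply/funext => j; apply/eqP; rewrite -(@Num.Theory.eqr_nat rat).
    by rewrite -qa -qa'.
  apply: LinCombNat => //; exists a => //.
  move: sb sc; rewrite aa' !is_sumE !big_nseq_onmul.
  have -> : onsum a (fun j => (\col_j (y j ord0 + z j ord0)) j ord0) =
      oadd (onsum a (fun j => y j ord0)) (onsum a (fun j => z j ord0)).
    by rewrite -onsumD; congr onsum; apply/funext => j; rewrite mxE.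
  (* In a [None] case, the corresponding [b] or [c] is an identity of [T]. *)
  case: (onsum a (fun j => y j ord0)) (onsum a (fun j => z j ord0))
    => [s|] [t|] //=.
  + by move=> -> ->.
  + by move=> -> ct; rewrite Algebra.addrC.
  + by move=> bs ->.
  + by move=> bs ct x; rewrite -Algebra.addrA ct.
- case=> [nc|[g gc]|_ nr]; last 1 first.
  + by case: nr; exists.
  + by case: nc; apply: rational_embeddable_cancellative; exists.
  apply: LinCombRat; exists f => e; rewrite re_add fb.
  rewrite (@rational_embedding_transfer g f _ (q ord0) (fun j => z j ord0) _ gc).
  rewrite -big_split; apply: eq_bigr => j _.
  by rewrite mxE re_add mulrDr.
- case=> [nc|[g _]|_ _ [a' qa' [g gc]]]; first by [].
    by case: nr; exists.
  have aa' : a' = a.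
    apply/funext => j; apply: (@intr_inj rat).
    by rewrite -qa -qa'.
  apply: LinCombInt => //; exists a => //; exists f.
  rewrite dg_add fb.
  have -> : f c = \sum_j f (z j ord0) *~ a j.
    (* The transfer is used with [d = 1] and a single coordinate, indexed by [unit]. *)
    rewrite -[LHS]mulr1n.
    apply: (int_relation_transfer (h := fun x (_ : unit) => g x)
              (g := fun x (_ : unit) => f x)) tt => //.
    + by move=> x x' _; apply: dg_add.
    + by move=> x x' _; apply: dg_add.
    + by move=> x x' /(congr1 (@^~ tt)); apply: dg_inj.
    + by move=> _; rewrite mulr1n gc aa'.
  rewrite -big_split; apply: eq_bigr => j _.
  by rewrite mxE dg_add mulrzDl.
Qed.

End LinearCombinations.

(** * Images of ultrafilters under maps *)

Section BetaMap.
Set Implicit Arguments.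
Unset Strict Implicit.
Variables (X Y : Type) (f : X -> Y).

Lemma beta_map_ultra (p : beta X) :
  UltraFilter [set B | beta_sets p (f @^-1` B)].
Proof.
have PF : ProperFilter [set B | beta_sets p (f @^-1` B)].
  split=> [|]; first exact: filter_not_empty.
  split=> [|P Q|P Q PQ] /=; first exact: filterT.
    by rewrite preimage_setI; apply: filterI.
  by apply: filterS => x; apply: PQ.
split=> // G GF sub; rewrite eqEsubset; split=> // B GB /=.
have [//|pnB] := betaC p (f @^-1` B).
have GnB : G (~` B) by apply: sub.
by exfalso; apply: (@filter_not_empty Y G GF); rewrite -(setICr B); apply: filterI.
Qed.

Definition beta_map (p : beta X) : beta Y := Beta (beta_map_ultra p).

Lemma beta_mapM (opX : X -> X -> X) (opY : Y -> Y -> Y) (p q : beta X) :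
  {morph f : x y / opX x y >-> opY x y} ->
  beta_map (beta_op opX p q) = beta_op opY (beta_map p) (beta_map q).
Proof.
move=> fM; apply: beta_inj => B /=; rewrite /ultra_op /=.
by apply: filterS => x; apply: filterS => y /=; rewrite fM.
Qed.

End BetaMap.

Lemma filter_finite_bigcap (X : Type) (I : choiceType) (S : set I)
    (B : I -> set X) (G : set_system X) :
  Filter G -> finite_set S -> (forall i, S i -> G (B i)) ->
  G (\bigcap_(i in S) B i).
Proof.
by move=> GF /finite_fsetP[E ->] GB; apply: filter_bigI => i iE; apply: GB.
Qed.

(** * The semigroup of constant and variable words *)

Section ConstantAndVariableWords.
Set Implicit Arguments.
Unset Strict Implicit.
Variables (A : eqType) (n : nat).

(* S_0 union S_n *)
Definition anyword : Type := (word A + vword A n)%type.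

Definition anyword_cat (x y : anyword) : anyword :=
  match x, y with
  | inl u, inl v => inl (word_cat u v)
  | inl u, inr w => inr (vword_catl u w)
  | inr w, inl u => inr (vword_catr w u)
  | inr w, inr t => inr (vword_cat w t)
  end.

Lemma word_catA : associative (@word_cat A).
Proof. by move=> u v w; apply: val_inj; rewrite /= catA. Qed.

Lemma anyword_catA : associative anyword_cat.
Proof.
by case=> u [] v [] w /=; congr (_ _); apply: val_inj; rewrite /= ?map_cat ?catA.
Qed.

Definition anyword_fold (nu : vword A n -> word A) (x : anyword) : word A :=
  match x with inl u => u | inr w => nu w end.

Lemma anyword_foldM nu : S0_preserving_hom nu ->
  {morph anyword_fold nu : x y / anyword_cat x y >-> word_cat x y}.
Proof.
by move=> [nuM nuS] [u|u] [v|v] //=; [case: (nuS u v)|case: (nuS v u)].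
Qed.

End ConstantAndVariableWords.

Theorem theorem2p10 (A : finType) (hA : (0 < #|A|)%N)
    (T : addSemigroupType) (k m n : nat)
    (hk : (0 < k)%N) (hm : (0 < m)%N) (hn : (0 < n)%N)
    (M : 'M[rat]_(k, m)) (hM : admissible_matrix T M)
    (tau : 'I_m -> vword A n -> T)
    (htau : forall j, S0_independent_hom (tau j))
    (p : 'I_k -> beta T)
    (hp_idem : (fun i => beta_op +%R (p i) (p i)) = p)
    (hp : forall B : 'I_k -> set T, (forall i, beta_sets (p i) (B i)) ->
       exists2 z, range (psi tau) z & mulmx_in M z B)
    (F : set (vword A n -> word A))
    (hF_fin : finite_set F) (hF_ne : F !=set0)
    (hF : forall nu, F nu -> S0_preserving_hom nu)
    (D : set (word A)) (hD : piecewise_syndetic (@word_cat A) D) :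
  forall B : 'I_k -> set T, (forall i, beta_sets (p i) (B i)) ->
    exists w : vword A n,
      (forall nu, F nu -> D (nu w)) /\ mulmx_in M (psi tau w) B.
Proof.
move=> B pB.
have [p0 /smallest_ideal_left_simple p0s p0D] := hD.
have [r [rr p0r rmin]] := left_simple_idempotent (@word_catA A) (p0s (@word_catA A)).
pose X := anyword A n; pose op := @anyword_cat A n.
have opA : associative op := @anyword_catA A n.
pose r' : beta X := beta_map inl r.
have r'r' : beta_op op r' r' = r' by rewrite -(beta_mapM (opX := @word_cat A)) ?rr.
(* The preimage of [C] under row [i] of w |-> M psi(w). Constant words are excluded, so that members
   of [Q] live on variable words. *)
pose ev i (C : set T) : set X :=
  [set x | if x is inr w then exists2 b, C b & lin_comb (row i M) (psi tau w) b
           else False].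
pose Q : set (beta X) :=
  [set q | forall i C, beta_sets (p i) C -> beta_sets q (ev i C)].
have psi_catl u w : psi tau (vword_catl u w) = psi tau w.
  by apply/colP => j; rewrite !mxE; case: (htau j) => _ /(_ u w)[].
have psi_catr u w : psi tau (vword_catr w u) = psi tau w.
  by apply/colP => j; rewrite !mxE; case: (htau j) => _ /(_ u w)[].
have clQ : beta_closed Q.
  by move=> q qQ i C piC; apply: qQ => s; apply.
have Qn : Q !=set0.
  (* By [hp] these intersections are nonempty; intersecting the [C i] coordinatewise shows that they
     form a filter base. *)
  pose G : set_system X := [set W | exists2 C : 'I_k -> set T,
    forall i, beta_sets (p i) (C i) & \bigcap_(i in setT) ev i (C i) `<=` W].
  have GP : ProperFilter G.
    split=> [[C pC]|].
      have [_ [w _ <-] MC] := hp _ pC.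
      by move=> /(_ (inr w)); apply => i _; apply: MC.
    split=> [|W V [C pC CW] [E pE EV]|W V WV [C pC CW]].
    - by exists (fun=> setT) => // i; apply: filterT.
    - exists (fun i => C i `&` E i) => [i|x xCE]; first exact: filterI.
      split; [apply: CW|apply: EV] => i _; move: (xCE i I);
        by case: x {xCE} => //= w [b []]; exists b.
    - by exists C => // x /CW/WV.
  have [q Gq] := beta_extend GP.
  exists q => i C piC; apply: Gq; exists (fun j => if j == i then C else setT).
    by move=> j; case: eqP => [->//|_]; apply: filterT.
  by move=> x /(_ i I); rewrite eqxx.
have QM q s : Q q -> Q s -> Q (beta_op op q s).
  (* Since [p i] is idempotent, [C] in [p i] means that for [p i]-many [b] there are [p i]-many [c]
     with [b + c] in [C]. *)
  move=> Qq Qs i C; rewrite -{1}(congr1 (@^~ i) hp_idem) /= => /Qq.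
  apply: filterS => -[//|w] [b /Qs Cb wb]; apply: filterS Cb => -[//|t] [c Cbc tc].
  exists (b + c) => //; have -> : psi tau (vword_cat w t) =
      \col_j (psi tau w j ord0 + psi tau t j ord0).
    by apply/colP => j; rewrite !mxE; case: (htau j).
  exact: lin_combD.
have Ql q : Q q -> Q (beta_op op r' q).
  move=> Qq i C /Qq qC /=; rewrite /ultra_op /=.
  apply: filterS (@filterT _ r _) => u _ /=; apply: filterS qC.
  by case=> //= w; rewrite psi_catl.
have Qr q : Q q -> Q (beta_op op q r').
  move=> Qq i C /Qq; apply: filterS => -[//|w] wC /=.
  by apply: filterS (@filterT _ r _) => u _ /=; rewrite psi_catr.
have [||_ _ [q Qq <-] [s Qs <-]|_ [q Qq <-] ee] :=
    beta_idempotent opA (C := [set beta_op op q r' | q in Q]).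
- exact: beta_closed_mulr.
- by have [q Qq] := Qn; exists (beta_op op q r'); exists q.
(* The product of q r' and s r' is (q (r' s)) r', and [Q] absorbs [r']. *)
- exists (beta_op op q (beta_op op r' s)); first by apply: QM => //; apply: Ql.
  by rewrite !beta_opA.
pose e := beta_op op q r'; pose f := beta_op op r' e.
have er : beta_op op e r' = e by rewrite /e -beta_opA // r'r'.
have fr : beta_op op f r' = f by rewrite /f -beta_opA // er.
have rf : beta_op op r' f = f by rewrite /f beta_opA // r'r'.
have ff : beta_op op f f = f.
  by rewrite {2}/f beta_opA // fr {1}/f -beta_opA // ee.
have fE nu : F nu -> beta_map (anyword_fold nu) f = r.
  move=> /hF/anyword_foldM nuM.
  (* On constant words [anyword_fold nu] is the identity. *)
  have nur : beta_map (anyword_fold nu) r' = r by apply: beta_inj.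
  have numM s t : beta_op (@word_cat A) (beta_map (anyword_fold nu) s)
      (beta_map (anyword_fold nu) t) = beta_map (anyword_fold nu) (beta_op op s t).
    exact/esym/beta_mapM.
  apply: rmin; first by rewrite numM ff.
    by rewrite -{1}nur numM fr.
  by rewrite -{1}nur numM rf.
(* As p0 = p0 r contains [D], the translate x^-1 D lies in [r] for [p0]-many [x]. *)
have [x rx] : exists x, beta_sets r [set y | D (word_cat x y)].
  by move: p0D; rewrite -p0r => p0rD; apply: (@filter_ex _ (beta_sets p0)) p0rD.
have fD : beta_sets f
    (\bigcap_(nu in F) [set z | D (word_cat x (anyword_fold nu z))]).
  apply: filter_finite_bigcap => // nu Fnu.
  suff : beta_sets (beta_map (anyword_fold nu) f) [set y | D (word_cat x y)] by [].
  by rewrite fE.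
have fB : beta_sets f (\bigcap_(i in setT) ev i (B i)).
  apply: filter_finite_bigcap => [|i _]; first exact: finite_finset.
  exact: (Ql _ (Qr _ Qq)).
have [z [zD zB]] := filter_ex (filterI fD fB).
(* A first row exists because [0 < k], and its [ev] contains no constant word. *)
case: z zD zB => [u _ /(_ (Ordinal hk) I)//|w wD wB].
(* Prefixing [x] turns nu(w) into x nu(w), which lies in [D], and leaves [psi] unchanged. *)
exists (vword_catl x w); split=> [nu Fnu|i]; last by rewrite psi_catl; apply: wB.
by have [_ /(_ x w)[-> _]] := hF nu Fnu; apply: wD.
Qed.
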